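(* Let $F$ be a field of characteristic zero and $n\ge1$. Then $\mathrm{rb}_\lambda(M_n(F))=2n-1$ for all $\lambda\in F$.
   Context: $M_n(F)$ is the associative algebra of $n\times n$ matrices over $F$. For an algebra $A$ over $F$ and $\lambda\in F$, a linear operator $R\colon A\to A$ is a Rota--Baxter operator of weight $\lambda$ if $R(x)R(y)=R(R(x)y+xR(y)+\lambda xy)$ for all $x,y\in A$. The Rota--Baxter $\lambda$-index of $A$ is $$\mathrm{rb}_\lambda(A)=\min\{m\in\mathbb N\mid \text{for every Rota--Baxter operator } R \text{ of weight }\lambda\text{ on }A\text{ there exists } 0\le k\le m \text{ with } R^k(R+\lambda\,\mathrm{id})^{m-k}=0\},$$ and $\mathrm{rb}_\lambda(A)=\infty$ if no such $m$ exists. *)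

(* Defs.v *)
From HB Require Import structures.
From mathcomp Require Import all_boot all_order all_algebra boolp.

Set Implicit Arguments.
Unset Strict Implicit.
Unset Printing Implicit Defensive.

Import GRing.Theory.
Local Open Scope ring_scope.

Definition RotaBaxter (F : fieldType) (A : algType F) (lam : F)
    (R : {linear A -> A}) : Prop :=
  forall x y : A, R x * R y = R (R x * y + x * R y + lam *: (x * y)).

(* [R ^ k (R + lam id) ^ (m - k) = 0] as an operator on A, stated pointwise. *)
Definition RBpow_vanish (F : fieldType) (A : algType F) (lam : F)
    (R : {linear A -> A}) (k m : nat) : Prop :=
  forall x : A,
    iter k R (iter (m - k) (fun y => R y + lam *: y) x) = 0.

Definition rb_bound (F : fieldType) (A : algType F) (lam : F) (m : nat) : Prop :=
  forall R : {linear A -> A}, RotaBaxter lam R ->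
    exists2 k : nat, (k <= m)%N & RBpow_vanish lam R k m.

(* The least m such that P m; [None] stands for infinity (no such m). *)
Definition min_nat (P : nat -> Prop) : option nat :=
  if pselect (exists m, `[< P m >]) is left exP then Some (ex_minn exP)
  else None.

Definition rb_index (F : fieldType) (A : algType F) (lam : F) : option nat :=
  min_nat (rb_bound A lam).
Arguments rb_index {F} A lam.

(* Main.v *)
(** Put N = n + 1, a = R(1), u = R (R + lam), and let L and Q be the left and
    right multiplications by a.  The Rota-Baxter identity at (1, x) and (x, 1)
    says [L, R] = [Q, R] = u, so taking k times the commutator with R sends a
    polynomial of degree k in L, Q to a multiple of k! u^k.

    Upper bound.  By Cayley-Hamilton u^N = 0, and u^n = 0 as soon as the minimal
    polynomial of a has degree < N.  The divided difference of the
    characteristic polynomial at (L, Q) is killed by L - Q, hence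
    (L - Q) u^n = 0.  Moreover R^N (R + lam)^N 1 = 0 reads
    prod_{-N <= j < N} (a - j lam) = 0.
    - If lam <> 0, then a is diagonalizable, with distinct eigenvalues unless
      u^n = 0.  So M_N is the sum of Im (L - Q) and of the N-dimensional
      centralizer of a, which R preserves; a Fitting argument on the centralizer
      gives R^N (R + lam)^n = 0 or R^n (R + lam)^N = 0.
    - If lam = 0, then a^N = 0 and we may assume a^n <> 0.  With
      G(x) = sum_i a^(n-i) x a^i, the operator R^(2n+1) is a combination of the
      R^(N-i) G R^i with 0 < i.  The image of G R^i is an ideal of F[a] which
      strictly decreases with i until it vanishes, so it lies in a^i F[a], and
      this is killed by R^(N-i).

    Lower bound.  With J the nilpotent Jordan block, let R0(K) be the H with zero
    first row such that J H - H J = K outside the first column.  Then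
    R(K) = R0(K (1 + lam J)) is a Rota-Baxter operator of weight lam.  As R0
    raises i - j by one on matrix units E_ij, a product of 2n factors R or R + lam
    sends E_(0,n) to a matrix with entry +-1 at (n,0). *)

From HB Require Import structures.
Require Import Defs.
From mathcomp Require Import all_boot all_order all_algebra all_field ring zify.

Set Implicit Arguments.
Unset Strict Implicit.
Unset Printing Implicit Defensive.

Import GRing.Theory.
Local Open Scope ring_scope.

(** * Iterated commutators *)

Section Ad.
Variables (F : fieldType) (E : algType F).
Implicit Types (r v X Y : E).

Definition ad r X := X * r - r * X.

Lemma ad_is_linear r : linear (ad r).
Proof.
move=> c X Y; rewrite /ad mulrDl mulrDr scalerBr -scalerAl -scalerAr opprD.
by rewrite addrACA.
Qed.

HB.instance Definition _ r :=
  GRing.isSemilinear.Build F E E _ (ad r)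
    (GRing.semilinear_linear (ad_is_linear r)).

Definition adn r k X := iter k (ad r) X.
Arguments adn : simpl never.

Lemma adnS r k X : adn r k.+1 X = ad r (adn r k X).
Proof. by []. Qed.

Lemma adn_is_linear r k : linear (adn r k).
Proof. by move=> c X Y; elim: k => // k IH; rewrite !adnS IH linearP. Qed.

HB.instance Definition _ r k :=
  GRing.isSemilinear.Build F E E _ (adn r k)
    (GRing.semilinear_linear (adn_is_linear r k)).

Lemma adM r X Y : ad r (X * Y) = ad r X * Y + X * ad r Y.
Proof.
by rewrite /ad mulrBl mulrBr !mulrA [RHS]addrC addrA addrNK.
Qed.

Lemma ad0 r X : GRing.comm r X -> ad r X = 0.
Proof. by rewrite /ad => ->; rewrite subrr. Qed.

Lemma adnM_comm r k X Y : GRing.comm r X -> adn r k (X * Y) = X * adn r k Y.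
Proof.
move=> cX; elim: k => //= k IH.
by rewrite !adnS IH adM ad0 // mul0r add0r.
Qed.

(* The defining property of products of [k] factors having commutator [v]. *)
Definition ad_degree r v k X := adn r k X = v ^+ k *+ k`!.

(** Leibniz rule cut after one commutator of [Y]: since [v] commutes with [r], all further
    commutators of [Y] vanish. *)
Lemma adn_mul r v k X Y : GRing.comm r v -> ad r Y = v ->
  adn r k.+1 (X * Y) = adn r k.+1 X * Y + (adn r k X * v) *+ k.+1.
Proof.
move=> rv adY; elim: k => [|k IH]; first by rewrite !adnS adM adY.
rewrite adnS IH linearD /= linearMn /= !adM.
by rewrite adY (ad0 rv) mulr0 addr0 -addrA -mulrS.
Qed.

Lemma ad_degree0 r v : ad_degree r v 0 1.
Proof. by []. Qed.

Lemma ad_degreeM r v k X Y : GRing.comm r v -> ad r Y = v ->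
  ad_degree r v k X -> ad_degree r v k.+1 (X * Y).
Proof.
move=> rv adY dX; rewrite /ad_degree (adn_mul _ _ rv) //.
rewrite adnS dX linearMn /= ad0; last exact: commrX.
by rewrite mul0rn mul0r add0r mulrnAl -mulrnA -exprSr mulnC factS.
Qed.

Lemma ad_degreeX r v k i X Y : GRing.comm r v -> ad r Y = v ->
  ad_degree r v k X -> ad_degree r v (k + i) (X * Y ^+ i).
Proof.
move=> rv adY dX; elim: i => [|i IH]; first by rewrite addn0 mulr1.
by rewrite addnS exprSr mulrA; apply: ad_degreeM.
Qed.

Lemma ad_degree_eq0 r v j k X : GRing.comm r v -> (j < k)%N ->
  ad_degree r v j X -> adn r k X = 0.
Proof.
move=> rv /subnK<- dX; rewrite /adn iterD -/(adn r _ X) adnS dX.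
rewrite linearMn /= ad0 ?mul0rn; last exact: commrX.
exact: raddf0 (adn r _).
Qed.

(** The iterated commutator is a signed binomial combination of these products. The coefficients
    never have to be written down, because the induction carries outer powers of [r] on both sides,
    which absorb one commutator at a time. *)
Lemma adn_sum_eq0 r k X :
  (forall i, (i <= k)%N -> r ^+ i * X * r ^+ (k - i) = 0) -> adn r k X = 0.
Proof.
suff main a b : (forall i, (i <= k)%N -> r ^+ (a + i) * X * r ^+ (b + (k - i)) = 0)
    -> r ^+ a * adn r k X * r ^+ b = 0.
  by move=> h; have := main 0%N 0%N h; rewrite mul1r mulr1.
elim: k a b => [|k IH] a b h; first by have := h 0%N isT; rewrite !addn0.
rewrite adnS /ad mulrBr mulrBl.
rewrite !mulrA -[_ * r * r ^+ b]mulrA -exprS -exprSr !IH ?subrr // => i ik.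
  by rewrite addSnnS h // ltnS.
by rewrite addSnnS -subSn // h // leqW.
Qed.

(* (p(X) - p(Y)) / (X - Y) *)
Definition divided_diff (p : {poly F}) X Y : E :=
  \sum_(k < size p) p`_k *: \sum_(i < k) X ^+ (k.-1 - i) * Y ^+ i.

Lemma horner_alg_coef (p : {poly F}) X :
  horner_alg X p = \sum_(k < size p) p`_k *: X ^+ k.
Proof.
rewrite [LHS]horner_coef size_map_poly; apply: eq_bigr => k _.
by rewrite coef_map /= mulr_algl.
Qed.

Lemma divided_diffP (p : {poly F}) X Y : GRing.comm X Y ->
  (X - Y) * divided_diff p X Y = horner_alg X p - horner_alg Y p.
Proof.
move=> XY; rewrite !horner_alg_coef -sumrB mulr_sumr; apply: eq_bigr => k _.
by rewrite -scalerAr -scalerBr (subrXX_comm k XY).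
Qed.

Section TopDegree.
Variables (r v X Y : E).
Hypotheses (rv : GRing.comm r v) (adX : ad r X = v) (adY : ad r Y = v).

Lemma ad_degree_monomial i j : ad_degree r v (i + j) (X ^+ i * Y ^+ j).
Proof.
apply: ad_degreeX => //; rewrite -[X ^+ i]mul1r.
exact: (ad_degreeX i rv adX (ad_degree0 r v)).
Qed.

Lemma adn_horner (p : {poly F}) k : p \is monic -> size p = k.+1 ->
  adn r k (horner_alg X p) = v ^+ k *+ k`!.
Proof.
move=> pm sp; rewrite horner_alg_coef sp big_ord_recr /= linearD raddf_sum /=.
rewrite linearZ /=; have -> : p`_k = 1 by move/monicP: pm; rewrite /lead_coef sp.
rewrite scale1r big1 => [|i _].
  by have := ad_degree_monomial k 0; rewrite mulr1 addn0 add0r.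
rewrite linearZ /= (@ad_degree_eq0 r v i) ?scaler0 //.
by have := ad_degree_monomial i 0; rewrite mulr1 addn0.
Qed.

Lemma adn_divided_diff (p : {poly F}) k : p \is monic -> size p = k.+2 ->
  adn r k (divided_diff p X Y) = v ^+ k *+ (k`! * k.+1).
Proof.
move=> pm sp; rewrite /divided_diff sp big_ord_recr /= linearD raddf_sum /=.
(* The constant coefficient carries an empty sum, and the coefficient of index [j.+1] carries
   monomials of degree [j < k]. Only the top coefficient survives, with [k.+1] monomials. *)
rewrite [X in X + _]big1 => [|[[|j] ij] _]; last first.
- rewrite /= linearZ /= raddf_sum big1 ?scaler0 //= => i _.
  rewrite (@ad_degree_eq0 r v j) //.
  by have := ad_degree_monomial (j - i) i; rewrite subnK // -ltnS.
- by rewrite /= big_ord0 scaler0 raddf0.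
rewrite add0r linearZ /= raddf_sum.
have -> : p`_k.+1 = 1 by move/monicP: pm; rewrite /lead_coef sp.
rewrite scale1r (eq_bigr (fun=> v ^+ k *+ k`!)) => [|i _ /=].
  by rewrite sumr_const card_ord mulrnA.
by have := ad_degree_monomial (k - i) i; rewrite subnK // -ltnS.
Qed.

End TopDegree.
End Ad.

Lemma mulrn_eq0_char0 (F : fieldType) (V : lmodType F) (x : V) (m : nat) :
  [pchar F] =i pred0 -> (0 < m)%N -> x *+ m = 0 -> x = 0.
Proof.
move=> /pcharf0P F0 m0; rewrite -scaler_nat => /eqP.
by rewrite scaler_eq0 F0 -leqn0 leqNgt m0 => /eqP.
Qed.

Import FalgLfun.

(** * Rota-Baxter operators on unital algebras *)

Section RotaBaxterOperator.
Variables (F : fieldType) (A : falgType F) (lam : F) (R : {linear A -> A}).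
Hypothesis F0 : [pchar F] =i pred0.
Hypothesis RB : RotaBaxter lam R.

(* In ['End(A)] the product [f * g] is [g] after [f]. *)
Definition rbop : 'End(A) := linfun R.
Definition rbopS : 'End(A) := rbop + lam *: 1.
Local Notation r := rbop.
Local Notation s := rbopS.
Local Notation u := (r * s).
Local Notation a := (R 1).
Local Notation L := (amull a).
Local Notation Q := (amulr a).

Lemma rbopE x : r x = R x.
Proof. exact: lfunE. Qed.

Lemma rbopSE x : s x = R x + lam *: x.
Proof. by rewrite add_lfunE scale_lfunE id_lfunE rbopE. Qed.

Lemma lfunXE (f : 'End(A)) (g : A -> A) k x : f =1 g -> (f ^+ k) x = iter k g x.
Proof.
move=> fg; elim: k => [|k IH]; first by rewrite id_lfunE.
by rewrite exprSr lfun_mulE IH fg.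
Qed.

Lemma amullE (x y : A) : amull x y = x * y.
Proof. by rewrite lfunE. Qed.

Lemma natmul_lfunE (f : 'End(A)) k x : (f *+ k) x = f x *+ k.
Proof.
elim: k => [|k IH]; first by rewrite !mulr0n zero_lfunE.
by rewrite !mulrS add_lfunE IH.
Qed.

Lemma RBpow_vanishE k m :
  RBpow_vanish lam R k m <-> s ^+ (m - k) * r ^+ k = 0.
Proof.
split=> [h | /lfunP h x].
  apply/lfunP => x; rewrite lfun_mulE (lfunXE _ _ rbopSE) (lfunXE _ _ rbopE).
  by rewrite zero_lfunE.
by have := h x; rewrite lfun_mulE (lfunXE _ _ rbopSE) (lfunXE _ _ rbopE) zero_lfunE.
Qed.

Lemma comm_rs : GRing.comm r s.
Proof.
apply: commrD => //; rewrite /GRing.comm.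
by rewrite -scalerAr -scalerAl mulr1 mul1r.
Qed.

Lemma rbopuE x : u x = R (R x) + lam *: R x.
Proof. by rewrite lfun_mulE rbopSE rbopE. Qed.

Lemma comm_ru : GRing.comm r u.
Proof. by apply: commrM => //; exact: comm_rs. Qed.

(** This is the Rota-Baxter identity at (1, x). The sign comes from the reversed product of
    ['End(A)]. *)
Lemma ad_L : ad r L = - u.
Proof.
apply/lfunP => x; rewrite opp_lfunE rbopuE.
rewrite add_lfunE opp_lfunE !lfun_mulE !lfunE /= RB !mul1r !linearD linearZ /=.
by rewrite !addrA subrr add0r.
Qed.

Lemma ad_Q : ad r Q = - u.
Proof.
apply/lfunP => x; rewrite opp_lfunE rbopuE.
rewrite add_lfunE opp_lfunE !lfun_mulE !lfunE /= RB !mulr1 !linearD linearZ /=.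
by rewrite [- R (R x) - R (x * a)]addrC !addrA subrr add0r.
Qed.

Lemma amullX (x : A) k : amull x ^+ k = amull (x ^+ k).
Proof.
elim: k => [|k IH]; first by rewrite amull1.
by rewrite exprSr IH exprS amullM.
Qed.

Lemma amull_horner (p : {poly F}) (x : A) :
  horner_alg (amull x) p = amull (horner_alg x p).
Proof.
rewrite !horner_alg_coef raddf_sum; apply: eq_bigr => k _ /=.
by rewrite linearZ /= amullX.
Qed.

Lemma amulr_horner (p : {poly F}) (x : A) :
  horner_alg (amulr x) p = amulr (horner_alg x p).
Proof.
rewrite !horner_alg_coef raddf_sum; apply: eq_bigr => k _ /=.
by rewrite linearZ /= rmorphXn.
Qed.

Lemma comm_rNu : GRing.comm r (- u).
Proof. by apply: commrN; exact: comm_ru. Qed.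

Lemma rb_annihilator (p : {poly F}) k :
  p \is monic -> size p = k.+1 -> horner_alg a p = 0 -> u ^+ k = 0.
Proof.
move=> pm sp pa; have := adn_horner comm_rNu ad_L ad_Q pm sp.
rewrite amull_horner pa !raddf0 exprNn -mulrnAr => /esym/eqP.
rewrite -signr_odd mulr_sign; case: odd => /eqP.
  by move/eqP; rewrite oppr_eq0 => /eqP; apply: mulrn_eq0_char0 (fact_gt0 k).
exact: mulrn_eq0_char0 (fact_gt0 k).
Qed.

Lemma comm_rT : GRing.comm r (L - Q).
Proof.
apply/esym/eqP; rewrite -subr_eq0; apply/eqP.
by rewrite -[LHS]/(ad r (L - Q)) linearB /= ad_L ad_Q subrr.
Qed.

Lemma comm_LQ : GRing.comm L Q.
Proof. by apply/lfunP => x; rewrite !lfun_mulE !lfunE /= mulrA. Qed.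

Lemma rb_commutator (x : A) : R (a * x - x * a) = a * R x - R x * a.
Proof.
have /lfunP/(_ x) := comm_rT; rewrite !lfun_mulE !add_lfunE !opp_lfunE.
by rewrite !lfunE /= => <-.
Qed.

(** [L - Q] commutes with [r], so it can be pulled out of the commutators of (L - Q) *
    [divided_diff p L Q] = p(L) - p(Q) = 0. *)
Lemma rb_pow_commutator (p : {poly F}) k :
  p \is monic -> size p = k.+2 -> horner_alg a p = 0 -> (L - Q) * u ^+ k = 0.
Proof.
move=> pm sp pa; have := adnM_comm k (divided_diff p L Q) comm_rT.
rewrite divided_diffP; last exact: comm_LQ.
rewrite amull_horner amulr_horner pa.
have -> : amull 0 - amulr 0 = 0 :> 'End(A).
  by rewrite [amull 0]linear0 [amulr 0]linear0 subrr.
rewrite linear0.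
rewrite (adn_divided_diff comm_rNu ad_L ad_Q pm sp) mulrnAr => /esym.
move/mulrn_eq0_char0 => -/(_ F0); rewrite muln_gt0 fact_gt0 => /(_ isT).
rewrite exprNn -signr_odd mulr_sign; case: odd => //.
by rewrite mulrN => /eqP; rewrite oppr_eq0 => /eqP.
Qed.

Lemma ad_L_rs k l :
  ad L (r ^+ k * s ^+ l) = (r ^+ k * s ^+ l * s) *+ k + (r ^+ k * s ^+ l * r) *+ l.
Proof.
have adr : ad L r = u.
  by rewrite -[RHS]opprK -ad_L /ad opprB.
have ads : ad L s = u.
  rewrite linearD linearZ /= adr ad0 ?scaler0 ?addr0 //; exact: commr1.
have rX i : GRing.comm r (s ^+ i) by apply: commrX; exact: comm_rs.
have -> : ad L (r ^+ k * s ^+ l) = ad L (r ^+ k) * s ^+ l + r ^+ k * ad L (s ^+ l).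
  exact: adM.
have -> : ad L (r ^+ k) = (r ^+ k * s) *+ k.
  elim: k => [|k IH]; first by rewrite ad0 //; exact: commr1.
  by rewrite exprSr adM IH adr mulrnAl -!mulrA -comm_rs -mulrSr.
have -> : ad L (s ^+ l) = (r * s ^+ l) *+ l.
  elim: l => [|l IH]; first by rewrite ad0 //; exact: commr1.
  by rewrite exprSr adM IH ads mulrnAl !mulrA -(rX l) -mulrSr.
rewrite mulrnAl mulrnAr -!mulrA -exprS exprSr; congr (_ + _).
by rewrite -[s ^+ l * r](rX l).
Qed.

Local Notation f k l := ((r ^+ k * s ^+ l) 1).

(** Evaluate [ad_L_rs] at 1: since L(1) = R(1) and X = R^k (R + lam)^l commutes with R, the term
    X(L(1)) equals R(X(1)). *)
Lemma rb_one_L k l :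
  a * f k l = R (f k l) *+ l.+1 + s (f k l) *+ k.
Proof.
set X := r ^+ k * s ^+ l.
have cr : GRing.comm r X.
  by apply: commrM; apply: commrX => //; exact: comm_rs.
have /lfunP/(_ 1) := ad_L_rs k l; rewrite -/X.
rewrite add_lfunE opp_lfunE [in RHS]add_lfunE !natmul_lfunE.
rewrite ![(X * _) _]lfun_mulE [(L * X) 1]lfun_mulE !amullE mulr1 -(rbopE 1).
rewrite -[X (r 1)]lfun_mulE cr lfun_mulE !rbopE => /eqP.
rewrite subr_eq => /eqP->; by rewrite -addrA [LHS]addrC mulrSr.
Qed.

(** Expanding [s] as R + lam in [rb_one_L] leaves a scalar multiple of [f k l], absorbed by shifting
    [a]. A linear factor in [a] thus raises [k] by one; [rb_one_s] does the same for [l]. *)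
Lemma rb_one_r k l :
  (a - (k%:R * lam)%:A) * f k l = R (f k l) *+ (k + l).+1.
Proof.
rewrite mulrBl rb_one_L rbopSE mulr_algl mulrnDl -scalerA scaler_nat.
by rewrite addrA addrK -mulrnDr addSn addnC.
Qed.

Lemma rb_one_s k l :
  (a - (- (l.+1%:R * lam))%:A) * f k l = s (f k l) *+ (k + l).+1.
Proof.
rewrite scaleNr opprK mulrDl rb_one_L mulr_algl -scalerA scaler_nat.
by rewrite addrAC -mulrnDl -rbopSE -mulrnDr addSn addnC.
Qed.

Definition rb_one_poly k l : {poly F} :=
  \prod_(i < k) ('X - (i%:R * lam)%:P) *
  \prod_(j < l) ('X - (- (j.+1%:R * lam))%:P).

Lemma rb_one_polyE k l : horner_alg a (rb_one_poly k l) = f k l *+ (k + l)`!.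
Proof.
have XE c : horner_alg a ('X - c%:P) = a - c%:A.
  by rewrite rmorphB /= horner_algX horner_algC.
have comm_horner (p q : {poly F}) :
    horner_alg a (p * q) = horner_alg a q * horner_alg a p.
  by rewrite mulrC rmorphM.
rewrite /rb_one_poly; elim: l => [|l IH]; last first.
  rewrite big_ord_recr /= mulrA comm_horner IH XE mulrnAr rb_one_s -mulrnA.
  by rewrite addnS factS exprSr mulrA [in RHS]lfun_mulE.
rewrite big_ord0 mulr1 addn0; elim: k => [|k IH].
  by rewrite big_ord0 rmorph1 lfun_mulE !id_lfunE.
rewrite big_ord_recr /= comm_horner IH XE mulrnAr -[k in k`!]addn0.
by rewrite rb_one_r -mulrnA addn0 factS !mulr1 exprSr lfun_mulE rbopE.
Qed.

End RotaBaxterOperator.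

(** * Polynomials in one matrix *)

Lemma horner_alg_mx (F : fieldType) n (B : 'M[F]_n.+1) (p : {poly F}) :
  horner_alg B p = horner_mx B p.
Proof.
elim/poly_ind: p => [|p c IH]; first by rewrite !rmorph0.
rewrite !rmorphD !rmorphM /= IH horner_algX horner_mx_X horner_algC horner_mx_C.
by rewrite scalemx1.
Qed.

(* If 0 is a root of multiplicity at most [n] of the characteristic polynomial,
   Bezout removes one factor [X] from [X ^ n.+1 (X + lam) ^ n.+1]. *)
Lemma mx_fitting (F : fieldType) n (Z : 'M[F]_n.+1) (lam : F) :
  Z ^+ n.+1 * (Z + lam%:M) ^+ n.+1 = 0 ->
  Z ^+ n.+1 = 0 \/ Z ^+ n * (Z + lam%:M) ^+ n.+1 = 0.
Proof.
move=> Z0; have [m [q]] := multiplicity_XsubC (char_poly Z) 0.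
rewrite monic_neq0 ?char_poly_monic //= => q0; rewrite subr0 => pE.
have pZ := Cayley_Hamilton Z; have := size_char_poly Z.
have qN0 : q != 0 by apply: contraNneq q0 => ->; rewrite root0.
rewrite pE size_mul ?expf_neq0 ?polyX_eq0 // size_polyXn addnS /= => sz.
have [mn|nm] := leqP m n; [right|left].
  have /Bezout_eq1_coprimepP[[v w] /= vw] : coprimep q 'X by rewrite coprimepX.
  set S := 'X + lam%:P; set P := 'X^n * S ^+ n.+1.
  have -> : Z ^+ n * (Z + lam%:M) ^+ n.+1 = horner_mx Z P.
    by rewrite rmorphM !rmorphXn rmorphD /= horner_mx_X horner_mx_C.
  have -> : P = v * S ^+ n.+1 * 'X^(n - m)%N * (q * 'X^m)
                 + w * ('X^(n.+1) * S ^+ n.+1).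
    rewrite -[LHS]mulr1 -vw /P [in 'X^(n.+1)]exprS.
    have -> : 'X^n = 'X^(n - m)%N * 'X^m :> {poly F}.
      by rewrite -exprD subnK.
    by ring.
  rewrite -pE rmorphD !rmorphM /= pZ mulr0 add0r !rmorphXn rmorphD /=.
  by rewrite horner_mx_X horner_mx_C Z0 mulr0.
(* Here 0 has multiplicity above [n], so by degree the characteristic polynomial is a constant times
   X^(n+1). *)
have q1 : (size q <= 1)%N.
  by rewrite -(leq_add2r m) sz add1n ltnS.
move: pE qN0 sz pZ; rewrite (size1_polyC q1) => ->; rewrite polyC_eq0 => c0.
rewrite size_polyC c0 add1n => -[->]; rewrite rmorphM /= horner_mx_C rmorphXn.
rewrite /= horner_mx_X => /eqP; rewrite -[_ * _]/(_ *m _) mul_scalar_mx scalemx_eq0.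
by rewrite (negPf c0) => /eqP.
Qed.

Lemma expr_eq0_leq (E : pzRingType) (x : E) i j :
  (i <= j)%N -> x ^+ i = 0 -> x ^+ j = 0.
Proof. by move=> /subnK<- x0; rewrite exprD x0 mulr0. Qed.

(** * Nonzero weight *)

Section DistinctEigenvalues.
Variables (F : fieldType) (n : nat) (d : 'rV[F]_n.+1).
Hypothesis d_inj : injective (d 0).

Lemma diag_commutatorE (z : 'M[F]_n.+1) i j :
  (diag_mx d * z - z * diag_mx d) i j = (d 0 i - d 0 j) * z i j.
Proof.
rewrite -![_ * _]/(_ *m _) mul_diag_mx mul_mx_diag !mxE mulrBl.
by rewrite [z i j * _]mulrC.
Qed.

(** Off the diagonal, divide by the nonzero differences of eigenvalues. On the diagonal the division
    by zero is harmless, as commutators with [diag_mx d] vanish there. *)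
Lemma diag_mx_decomp (c : 'M[F]_n.+1) :
  exists z, c = diag_mx (\row_i c i i) + (diag_mx d * z - z * diag_mx d).
Proof.
exists (\matrix_(i, j) (c i j / (d 0 i - d 0 j))).
apply/matrixP => i j; rewrite mxE diag_commutatorE !mxE.
have [->|ij] := eqVneq i j; first by rewrite mulr1n subrr mul0r addr0.
by rewrite add0r mulrC divfK // subr_eq0 (inj_eq d_inj).
Qed.

Lemma comm_diag_mxE (c : 'M[F]_n.+1) :
  GRing.comm (diag_mx d) c -> c = diag_mx (\row_i c i i).
Proof.
move=> dc; apply/matrixP => i j; rewrite !mxE.
have [->|ij] := eqVneq i j; first by rewrite mulr1n.
have := diag_commutatorE c i j; rewrite dc subrr mxE => /esym/eqP.
by rewrite mulf_eq0 subr_eq0 (inj_eq d_inj) (negPf ij) => /eqP.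
Qed.

End DistinctEigenvalues.

(** * Consequences of Cayley-Hamilton, and distinct eigenvalues *)

Section MatrixAlgebra.
Variables (F : fieldType) (n : nat) (lam : F).
Variable R : {linear 'M[F]_n.+1 -> 'M[F]_n.+1}.
Hypothesis F0 : [pchar F] =i pred0.
Hypothesis RB : RotaBaxter lam R.

Local Notation r := (rbop R).
Local Notation s := (rbopS lam R).
Local Notation u := (r * s).
Local Notation a := (R 1).
Local Notation T := (amull a - amulr a).

Lemma rb_minpoly_small : (degree_mxminpoly a <= n)%N -> u ^+ n = 0.
Proof.
move=> dn; have := rb_annihilator F0 RB (mxminpoly_monic a) (size_mxminpoly a).
rewrite horner_alg_mx mx_root_minpoly => /(_ erefl).
exact: expr_eq0_leq dn.
Qed.

Lemma rb_Cayley_Hamilton : u ^+ n.+1 = 0.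
Proof.
apply: (rb_annihilator F0 RB (char_poly_monic a) (size_char_poly a)).
by rewrite horner_alg_mx Cayley_Hamilton.
Qed.

Lemma rb_commutator_pow : T * u ^+ n = 0.
Proof.
apply: (rb_pow_commutator F0 RB (char_poly_monic a) (size_char_poly a)).
by rewrite horner_alg_mx Cayley_Hamilton.
Qed.

Lemma commutatorE x : T x = a * x - x * a.
Proof. by rewrite add_lfunE opp_lfunE !lfunE. Qed.

Lemma rb_one_poly_mx : horner_mx a (rb_one_poly lam n.+1 n.+1) = 0.
Proof.
rewrite -horner_alg_mx rb_one_polyE // -exprMn_comm; last exact: comm_rs.
by rewrite rb_Cayley_Hamilton zero_lfunE mul0rn.
Qed.

Lemma rb_distinct_eigenvalues (C : 'M[F]_n.+1) (d : 'rV[F]_n.+1) :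
    C \in unitmx -> C * a = diag_mx d * C -> injective (d 0) ->
  r ^+ n.+1 * s ^+ n = 0 \/ r ^+ n * s ^+ n.+1 = 0.
Proof.
move=> Cu Ca d_inj; have CV : C^-1 * C = 1 by exact: mulVr.
have VC : C * C^-1 = 1 by exact: mulrV.
(* [dl] identifies row vectors with the centralizer of [a], the matrices diagonal in its eigenbasis;
   [ld] reads the coordinates back, and [Z] below is the matrix of R on this centralizer. *)
pose dl y := C^-1 * diag_mx y * C.
have dlE x : x = C^-1 * (C * x * C^-1) * C.
  by rewrite !mulrA CV mul1r -mulrA CV mulr1.
have aE : a = dl d by rewrite /dl -mulrA -Ca mulrA CV mul1r.
have dlM y z : dl y * dl z = C^-1 * (diag_mx y * diag_mx z) * C.
  by rewrite /dl !mulrA -[X in X * diag_mx z * C]mulrA VC mulr1.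
have dl_comm y : a * dl y = dl y * a.
  by rewrite aE !dlM -![diag_mx _ * _]/(_ *m _) diag_mxC.
pose ld (x : 'M[F]_n.+1) := \row_i (C * x * C^-1) i i.
have ld_lin : linear (ld \o R \o dl).
  move=> c y z; rewrite /ld /dl /=; apply/rowP => i; rewrite linearP /=.
  rewrite mulrDr mulrDl -scalerAr -scalerAl linearP /= mulrDr mulrDl -scalerAr.
  by rewrite -scalerAl !mxE.
pose h := HB.pack_for {linear 'rV[F]_n.+1 -> 'rV[F]_n.+1} (ld \o R \o dl)
            (GRing.isLinear.Build _ _ _ _ _ ld_lin).
pose Z := lin1_mx h.
have comm_dl x : a * x = x * a -> x = dl (ld x).
  move=> ax; rewrite {1}[x]dlE /dl; congr (_ * _ * _).
  apply: (comm_diag_mxE d_inj); rewrite /GRing.comm.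
  have -> : diag_mx d = C * a * C^-1 by rewrite Ca -mulrA VC mulr1.
  by rewrite !mulrA -[_ * C^-1 * C]mulrA CV mulr1 -[C * a * x]mulrA ax !mulrA
             -[_ * C^-1 * C]mulrA CV mulr1.
(* R commutes with the commutator by [a], hence preserves the centralizer. *)
have rdl y : r (dl y) = dl (y *m Z).
  rewrite rbopE mul_rV_lin1 /=; apply: comm_dl; apply/eqP.
  by rewrite -subr_eq0 -(rb_commutator RB) dl_comm subrr linear0.
have dlD y z : dl (y + z) = dl y + dl z by rewrite /dl linearD /= mulrDr mulrDl.
have dlZ c y : dl (c *: y) = c *: dl y.
  by rewrite /dl linearZ /= -scalerAr -scalerAl.
have sdl y : s (dl y) = dl (y *m (Z + lam%:M)).
  by rewrite rbopSE -rbopE rdl mulmxDr mul_mx_scalar dlD dlZ.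
have rsdl k l y :
    (r ^+ k * s ^+ l) (dl y) = dl (y *m (Z ^+ k * (Z + lam%:M) ^+ l)).
  elim: l => [|l IH]; last first.
    by rewrite !exprSr !mulrA lfun_mulE IH sdl -mulmxA.
  rewrite !mulr1; elim: k => [|k IH]; first by rewrite id_lfunE mulmx1.
  by rewrite !exprSr lfun_mulE IH rdl -mulmxA.
have ldK y : ld (dl y) = y.
  apply/rowP => i; rewrite mxE /dl !mulrA VC mul1r -mulrA VC mulr1.
  by rewrite mxE eqxx.
have decomp x : exists y z, x = dl y + T z.
  have [z zE] := diag_mx_decomp d_inj (C * x * C^-1).
  exists (\row_i (C * x * C^-1) i i), (C^-1 * z * C).
  rewrite {1}[x]dlE {1}zE mulrDr mulrDl -/(dl _); congr (_ + _).
  rewrite commutatorE aE /dl mulrBr mulrBl !mulrA.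
  rewrite -[C^-1 * _ * C * C^-1]mulrA -[C^-1 * z * C * C^-1]mulrA VC.
  by rewrite !mulr1.
have Z0 : Z ^+ n.+1 * (Z + lam%:M) ^+ n.+1 = 0.
  apply/row_matrixP => i; rewrite !rowE -[LHS]ldK -rsdl.
  rewrite -exprMn_comm; last exact: comm_rs.
  rewrite rb_Cayley_Hamilton zero_lfunE mulmx0; apply/rowP => j.
  by rewrite mxE mulr0 mul0r !mxE.
(* The centralizer is governed by [Z]; the image of [T] is killed because [r ^+ k * s ^+ l] contains
   the factor [u ^+ n]. *)
have finish k l : (n <= k)%N -> (n <= l)%N ->
    Z ^+ k * (Z + lam%:M) ^+ l = 0 -> r ^+ k * s ^+ l = 0.
  move=> nk nl Zkl; apply/lfunP => x; have [y [z ->]] := decomp x.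
  rewrite linearD /= rsdl Zkl mulmx0 /dl linear0 mulr0 mul0r add0r zero_lfunE.
  have -> : r ^+ k * s ^+ l = u ^+ n * (r ^+ (k - n) * s ^+ (l - n)).
    have rs : GRing.comm r s by exact: comm_rs.
    rewrite exprMn_comm // -[in LHS](subnKC nk) -[in LHS](subnKC nl) !exprD.
    rewrite !mulrA; congr (_ * _); rewrite -!mulrA; congr (_ * _).
    by apply/esym/commrX/commr_sym/commrX/commr_sym.
  by rewrite -lfun_mulE mulrA rb_commutator_pow mul0r zero_lfunE.
have [Z1|Z1] := mx_fitting Z0; [left | right]; apply: finish => //.
by rewrite Z1 mul0r.
Qed.

End MatrixAlgebra.

Section UpperBoundNonzero.
Variables (F : fieldType) (n : nat) (lam : F).
Variable R : {linear 'M[F]_n.+1 -> 'M[F]_n.+1}.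
Hypothesis F0 : [pchar F] =i pred0.
Hypothesis RB : RotaBaxter lam R.

Local Notation r := (rbop R).
Local Notation s := (rbopS lam R).
Local Notation a := (R 1).

(** The roots of [rb_one_poly] are multiples of lam by distinct integers, hence simple in
    characteristic zero. *)
Lemma rb_one_diagonalizable : lam != 0 -> diagonalizable a.
Proof.
move=> lam0; apply/diagonalizableP.
exists ([seq i%:R * lam | i <- iota 0 n.+1] ++
        [seq - (j.+1%:R * lam) | j <- iota 0 n.+1]).
  have /pcharf0P N0 := F0.
  have natr_inj : injective (fun i : nat => i%:R : F).
    move=> i j /eqP; wlog ij : i j / (i <= j)%N => [h|].
      case/orP: (leq_total i j) => ij; first exact: h.
      by rewrite eq_sym => /(h _ _ ij).
    rewrite eq_sym -subr_eq0 -natrB // N0 subn_eq0 => ji.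
    by apply/eqP; rewrite eqn_leq ij.
  rewrite cat_uniq !map_inj_uniq ?iota_uniq ?andbT ?andTb; first last.
  - by move=> i j /(mulIf lam0)/natr_inj.
  - by move=> i j /oppr_inj/(mulIf lam0)/natr_inj[].
  apply/hasPn => _ /mapP[j _ ->]; apply/negP => /mapP[i _ /eqP].
  by rewrite eq_sym -addr_eq0 -mulrDl mulf_eq0 (negPf lam0) orbF -natrD N0 addnS.
apply: mxminpoly_min; rewrite -(rb_one_poly_mx F0 RB); congr horner_mx.
rewrite /rb_one_poly big_cat !big_map -[iota 0 _]/(index_iota 0 n.+1) !big_mkord.
by [].
Qed.

Lemma rb_nilpotent_nonzero : lam != 0 ->
  r ^+ n.+1 * s ^+ n = 0 \/ r ^+ n * s ^+ n.+1 = 0.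
Proof.
move=> lam0; have [dn|nd] := leqP (degree_mxminpoly a) n.
  left; rewrite exprS -mulrA -exprMn_comm; last exact: comm_rs.
  by rewrite rb_minpoly_small // mulr0.
have [P Pu /diagonalizable_forPex[d aPd]] := rb_one_diagonalizable lam0.
apply: (rb_distinct_eigenvalues F0 RB Pu (simmxP Pu aPd)).
(* The degree of the minimal polynomial of a diagonal matrix counts its distinct entries, and here
   it exceeds [n]. *)
apply/injectiveP; rewrite /injectiveb /dinjectiveb -[uniq _]negbK.
rewrite -ltn_size_undup -leqNgt size_map size_enum_ord; apply: leq_trans nd _.
have := size_mxminpoly a; rewrite (simmx_minpoly Pu aPd) mxminpoly_diag size_prod_XsubC.
by case=> <-.
Qed.

End UpperBoundNonzero.

(** * Weight zero *)

Section NilpotentCyclic.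
Variables (F : fieldType) (n : nat) (a : 'M[F]_n.+1).
Hypotheses (aN : a ^+ n.+1 = 0) (an : a ^+ n != 0).

Lemma expr_nilp k : (n < k)%N -> a ^+ k = 0.
Proof. by move/subnK<-; rewrite exprD aN mulr0. Qed.

(** With a^n v nonzero, the vectors v, a v, ..., a^n v form a basis; [phi] is the coordinate along
    a^n v. *)
Lemma nilpotent_dual_basis : exists (v : 'cV[F]_n.+1) (phi : 'rV[F]_n.+1),
  [/\ forall j, phi *m (a ^+ j *m v) = (j == n)%:R%:M,
      forall c : 'cV_n.+1, exists p, c = horner_mx a p *m v &
      forall x : 'M_n.+1, (forall j, x *m (a ^+ j *m v) = a ^+ j *m v) -> x = 1].
Proof.
have [i [j aij]] : exists i j, (a ^+ n) i j != 0. exact/matrix0Pn.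
pose v : 'cV[F]_n.+1 := delta_mx j 0.
pose psi : 'rV[F]_n.+1 := ((a ^+ n) i j)^-1 *: delta_mx 0 i.
have psiv : (psi *m (a ^+ n *m v)) 0 0 = 1.
  rewrite -scalemxAl -rowE -colE !mxE mulVf //.
pose B : 'M[F]_n.+1 := \matrix_(k, l) (a ^+ l *m v) k 0.
have BE (l : 'I_n.+1) : B *m delta_mx l (0 : 'I_1) = a ^+ (l : nat) *m v.
  by apply/colP => k; rewrite -colE !mxE.
(* [P *m B] has entries psi(a^(n-k+l) v), so it is lower triangular with unit diagonal, and [B] is
   invertible. *)
pose P : 'M[F]_n.+1 := \matrix_(k, l) (psi *m a ^+ (n - k)) 0 l.
have PBE k l : (P *m B) k l = (psi *m (a ^+ (n - k + l) *m v)) 0 0.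
  rewrite exprD -[a ^+ _ * _]/(_ *m _) -!mulmxA mulmxA !mxE.
  by apply: eq_bigr => q _; rewrite !mxE.
have Bu : B \in unitmx.
  have : P *m B \in unitmx.
    rewrite unitmxE det_trig.
      rewrite big1 ?unitr1 // => k _; rewrite PBE subnK // -ltnS.
      exact: ltn_ord.
    apply/is_trig_mxP => k l kl; rewrite PBE expr_nilp ?mul0mx ?mulmx0 ?mxE //.
    by have := ltn_ord k; move: kl; lia.
  by rewrite unitmx_mul => /andP[].
pose phi := row ord_max (invmx B).
exists v, phi; split.
- move=> k; have [kn|nk] := leqP k n; last first.
    rewrite expr_nilp // mul0mx mulmx0 gtn_eqF //.
    by apply/matrixP => ? ?; rewrite !mxE mul0rn.
  have -> : a ^+ k *m v = B *m delta_mx (inord k) 0 by rewrite BE inordK.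
  rewrite /phi -row_mul mulKmx //; apply/matrixP => p q.
  rewrite !mxE !ord1 !eqxx andbT mulr1n; congr (_%:R); rewrite -val_eqE /= inordK //.
  by rewrite eq_sym.
- move=> c; exists (\poly_(l < n.+1) (invmx B *m c) (inord l) 0).
  rewrite -[LHS](mulKVmx Bu); set g := invmx B *m c.
  rewrite poly_def raddf_sum /= mulmx_suml.
  rewrite [g in LHS]matrix_sum_delta mulmx_sumr; apply: eq_bigr => l _.
  rewrite big_ord1 -scalemxAr BE inord_val linearZ /= rmorphXn /= horner_mx_X.
  by rewrite -scalemxAl.
- move=> x xB; apply: (mulIr (x := B)) => //; rewrite mul1r.
  apply/matrixP => k l; have := congr1 (fun z : 'cV_n.+1 => z k 0) (xB l).
  by rewrite -BE mulmxA -!colE ![col _ _ _ _]mxE.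
Qed.

(** Take the rank one matrix w = v phi: on a^j v only the summand i = n - j survives, and it returns
    a^j v. If c commutes with [a], multiplying this identity by c shows that c is determined by c v,
    which is p(a) v for some p. *)
Lemma nilpotent_casimir : exists w : 'M[F]_n.+1,
  \sum_(i < n.+1) a ^+ (n - i) * w * a ^+ i = 1 /\
  forall c, GRing.comm a c -> exists p, c = horner_mx a p.
Proof.
have [v [phi [phiE cyc one]]] := nilpotent_dual_basis.
have w1 : \sum_(i < n.+1) a ^+ (n - i) * (v *m phi) * a ^+ i = 1.
  apply: one => j; have [jn|nj] := leqP j n; last first.
    by rewrite expr_nilp // mul0mx mulmx0.
  rewrite mulmx_suml (bigD1 (inord (n - j))) //= big1 ?addr0 => [|i ij].
    rewrite inordK ?ltnS ?leq_subr // subKn //.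
    rewrite -![_ * _]/(_ *m _) -!mulmxA [a ^+ (n - j) *m _]mulmxA.
    rewrite -[a ^+ _ *m a ^+ _]/(_ * _) -exprD subnK // phiE eqxx.
    by rewrite mulmx1.
  rewrite -![_ * _]/(_ *m _) -!mulmxA [a ^+ i *m _]mulmxA.
  rewrite -[a ^+ _ *m a ^+ _]/(_ * _) -exprD phiE.
  have -> : (i + j == n)%N = false.
    apply: contraNF ij => /eqP e; apply/eqP/val_inj; rewrite /= inordK; lia.
  by rewrite mul_mx_scalar scale0r mulmx0.
exists (v *m phi); split=> // c ac; have [p cp] := cyc (c *m v); exists p.
have cX i : c * a ^+ i = a ^+ i * c by exact: (commrX i (commr_sym ac)).
have hX i : horner_mx a p * a ^+ i = a ^+ i * horner_mx a p.
  by rewrite -{2 3}[a]horner_mx_X -!rmorphXn -!rmorphM mulrC.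
rewrite -[LHS]mulr1 -[RHS]mulr1 -w1 !mulr_sumr; apply: eq_bigr => i _.
rewrite !mulrA cX hX -[a ^+ _ * _ * _]mulrA -[a ^+ _ * horner_mx a p * _]mulrA.
by congr (_ * _ * _); rewrite -![_ * _]/(_ *m _) !mulmxA cp.
Qed.

End NilpotentCyclic.

Section UpperBoundZero.
Variables (F : fieldType) (n : nat).
Variable R : {linear 'M[F]_n.+1 -> 'M[F]_n.+1}.
Hypothesis F0 : [pchar F] =i pred0.
Hypothesis RB : RotaBaxter 0 R.

Local Notation r := (rbop R).
Local Notation a := (R 1).
Local Notation L := (amull a).
Local Notation Q := (amulr a).
Local Notation H := (horner_mx a).

Lemma rbopS0 : rbopS 0 R = r.
Proof. by rewrite /rbopS scale0r addr0. Qed.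

(** In weight zero the polynomial killing [a] is a power of X, hence so is the minimal polynomial,
    which divides the characteristic polynomial of degree n+1. *)
Lemma rb_one_nilpotent : a ^+ n.+1 = 0.
Proof.
have := rb_one_poly_mx F0 RB; rewrite /rb_one_poly.
rewrite (eq_bigr (fun=> 'X)) => [|i _]; last by rewrite mulr0 subr0.
rewrite [X in _ * X](eq_bigr (fun=> 'X)) => [|i _]; last by rewrite mulr0 oppr0 subr0.
rewrite !prodr_const card_ord -exprD => /mxminpoly_min.
rewrite -['X]subr0 => /dvdp_exp_XsubCP[k _].
rewrite subr0 eqp_monic ?mxminpoly_monic ?monicXn // => /eqP pE.
have kn : (k <= n.+1)%N.
  have := dvdp_leq (monic_neq0 (char_poly_monic a)) (mxminpoly_dvd_char a).
  by rewrite pE size_char_poly size_polyXn.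
have := mx_root_minpoly a; rewrite pE rmorphXn /= horner_mx_X => ak.
exact: expr_eq0_leq kn ak.
Qed.

(** Since a^k = k! R^k(1), R acts on powers of [a] like integration. *)
Lemma rb_power k : R (a ^+ k) *+ k.+1 = a ^+ k.+1.
Proof.
have aE j : a ^+ j = (r ^+ j) 1 *+ j`!.
  elim: j => [|j IH]; first by rewrite id_lfunE.
  have := rb_one_r RB j 0; rewrite mulr0 scale0r subr0 mulr1 addn0 => e.
  rewrite exprS IH mulrnAr e -mulrnA factS [in RHS]exprSr lfun_mulE rbopE.
  by [].
by rewrite !aE linearMn /= -mulrnA -rbopE -lfun_mulE -exprSr mulnC -factS.
Qed.

Lemma rb_ideal i (p : {poly F}) : exists q, R (a ^+ i * H p) = a ^+ i.+1 * H q.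
Proof.
have HE k (q : {poly F}) c :
    a ^+ k * H (q * 'X + c%:P) = a ^+ k.+1 * H q + c *: a ^+ k.
  rewrite rmorphD [q * 'X]mulrC rmorphM /= horner_mx_X horner_mx_C mulrDr mulrA.
  by rewrite -exprSr -[_ * c%:M]/(_ *m _) mul_mx_scalar.
elim/poly_ind: p i => [|p c IH] i; first by exists 0; rewrite !rmorph0 !mulr0 linear0.
have [q qE] := IH i.+1; exists (q * 'X + (c * (i.+1%:R)^-1)%:P).
rewrite !HE linearD linearZ /= qE -(rb_power i) -scaler_nat !scalerA divfK //.
by move/pcharf0P: F0 => ->.
Qed.

Lemma rb_iter_ideal m i (p : {poly F}) :
  exists q, (r ^+ m) (a ^+ i * H p) = a ^+ (i + m) * H q.
Proof.
elim: m => [|m [q qE]]; first by exists p; rewrite id_lfunE addn0.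
have [q' q'E] := rb_ideal (i + m) q.
by exists q'; rewrite exprSr lfun_mulE qE rbopE q'E addnS.
Qed.

Lemma rb_nilpotent : r ^+ (2 * n.+1) = 0.
Proof.
have := rb_Cayley_Hamilton F0 RB; rewrite rbopS0 => <-.
by rewrite -expr2 -exprM.
Qed.

Section Cyclic.
Hypothesis an : a ^+ n != 0.

Local Notation G := (\sum_(i < n.+1) L ^+ (n - i) * Q ^+ i).

Lemma casimirE x : G x = \sum_(i < n.+1) a ^+ (n - i) * x * a ^+ i.
Proof.
rewrite sum_lfunE; apply: eq_bigr => i _.
by rewrite lfun_mulE amullX -rmorphXn !lfunE.
Qed.

Lemma commutator_casimir : (L - Q) * G = 0.
Proof.
rewrite -(subrXX_comm n.+1 (comm_LQ R)) amullX -rmorphXn /=.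
by rewrite rb_one_nilpotent [amull 0]linear0 [amulr 0]linear0 subrr.
Qed.

Lemma casimir_comm x : GRing.comm a (G x).
Proof.
have cG : GRing.comm (L - Q) G.
  have LQ := comm_LQ R; have QL := commr_sym LQ.
  have TL : GRing.comm (L - Q) L by apply/commr_sym/commrB.
  have TQ : GRing.comm (L - Q) Q by apply/commr_sym/commrB.
  by apply: commr_sum => i _; apply: commrM; apply: commrX.
have := commutator_casimir; rewrite cG => /lfunP/(_ x).
rewrite lfun_mulE commutatorE zero_lfunE => /eqP.
by rewrite subr_eq0 => /eqP.
Qed.

Lemma casimir_mull x y : GRing.comm a y -> G (y * x) = y * G x.
Proof.
move=> ay; rewrite !casimirE mulr_sumr; apply: eq_bigr => i _.
by rewrite !mulrA (commrX _ (commr_sym ay)).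
Qed.

Lemma casimir_horner x : exists p, G x = H p.
Proof.
have [w [_ cyc]] := nilpotent_casimir rb_one_nilpotent an.
exact/cyc/casimir_comm.
Qed.

Lemma comm_horner_mx_a p : GRing.comm a (H p).
Proof.
by apply/commr_sym; rewrite /GRing.comm -{2 3}[a]horner_mx_X -!rmorphM mulrC.
Qed.

(** Modulo the image of [L - Q], powers of [a] move cyclically. Multiplying x by the sum of
    [nilpotent_casimir] therefore turns it into G(x) w = 0. *)
Lemma casimir_ker x : G x = 0 -> exists y, x = (L - Q) y.
Proof.
move=> Gx0; have [w [w1 _]] := nilpotent_casimir rb_one_nilpotent an.
have aT z i : z * a ^+ i - a ^+ i * z \in limg (L - Q).
  elim: i => [|i IH]; first by rewrite mulr1 mul1r subrr mem0v.
  have -> : z * a ^+ i.+1 - a ^+ i.+1 * z =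
    (z * a ^+ i - a ^+ i * z) * a - (L - Q) (a ^+ i * z).
    by rewrite commutatorE mulrBl opprB !mulrA addrA subrK -exprS -mulrA -exprSr.
  apply: rpredB; last exact/memv_img/memvf.
  have /memv_imgP[y _ ->] := IH.
  have -> : (L - Q) y * a = (L - Q) (y * a) by rewrite !commutatorE mulrBl !mulrA.
  exact/memv_img/memvf.
suff /memv_imgP[y _ ->] : x \in limg (L - Q) by exists y.
have -> : x = \sum_(i < n.+1) (x * a ^+ (n - i) * w * a ^+ i
                  - a ^+ i * (x * a ^+ (n - i) * w)).
  rewrite sumrB -[LHS]mulr1 -[X in x * X]w1 mulr_sumr -[LHS]subr0; congr (_ - _).
    by apply: eq_bigr => i _; rewrite !mulrA.
  apply/esym; transitivity (G x * w); last by rewrite Gx0 mul0r.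
  rewrite casimirE mulr_suml (reindex_inj rev_ord_inj); apply: eq_bigr => i _ /=.
  by rewrite subSS subKn -1?ltnS // !mulrA.
by apply: memv_suml => i _; exact: aT.
Qed.

(** G(x) determines x modulo the image of [L - Q], which R preserves and [G] kills. *)
Lemma casimir_congr k x y : G x = G y -> G ((r ^+ k) x) = G ((r ^+ k) y).
Proof.
move=> /eqP; rewrite -subr_eq0 -linearB => /eqP/casimir_ker[z xy].
rewrite -[x](subrK y) xy !linearD /= -[RHS]add0r; congr (_ + _).
rewrite -[(r ^+ k) _]lfun_mulE (commrX k (commr_sym (comm_rT RB))) lfun_mulE.
have /lfunP/(_ ((r ^+ k) z)) := commutator_casimir.
by rewrite lfun_mulE zero_lfunE => ->.
Qed.

Lemma rb_casimir_mull k (p : {poly F}) x :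
  exists y, H p * G ((r ^+ k) x) = G ((r ^+ k) y).
Proof.
elim/poly_ind: p x => [|p c IH] x.
  by exists 0; rewrite rmorph0 mul0r !linear0.
have aG : exists y, a * G ((r ^+ k) x) = G ((r ^+ k) y).
  (* The witness comes from a R^k(x) = R^k(a x) + k R^(k+1)(x), which is [ad_L_rs] in weight
     zero. *)
  exists (a * x + r x *+ k); rewrite -casimir_mull //; congr (G _).
  have /lfunP/(_ x) := ad_L_rs RB k 0; rewrite rbopS0 !mulr1 mulr0n addr0.
  rewrite add_lfunE opp_lfunE natmul_lfunE !lfun_mulE !amullE => /eqP.
  rewrite subr_eq => /eqP->; rewrite linearD linearMn /= addrC; congr (_ + _ *+ _).
  by rewrite -!lfun_mulE -exprS -exprSr.
have [y yE] := aG; have [z zE] := IH y.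
exists (z + c *: x); rewrite rmorphD rmorphM /= horner_mx_X horner_mx_C mulrDl.
rewrite -mulrA yE zE linearD linearZ linearD linearZ /=; congr (_ + _).
by rewrite -[_%:M * _]/(_ *m _) mul_scalar_mx.
Qed.

(* If some [G (R^(i+1) x)] is [a ^+ i] times a unit of [F[a]], then [G R^i] and
   [G R^(i+1)] have the same image, which is therefore 0 by nilpotency. *)
Lemma casimir_rb_ideal i x : exists p, G ((r ^+ i) x) = a ^+ i * H p.
Proof.
elim: i x => [|i IH] x.
  by have [p pE] := casimir_horner x; exists p; rewrite id_lfunE mul1r.
have [p pE] := IH (r x); have [p0|p0] := boolP (root p 0).
  have /factor_theorem[q qE] := p0; exists q.
  rewrite exprS lfun_mulE pE qE subr0 mulrC rmorphM /= horner_mx_X mulrA.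
  by rewrite -exprSr.
have sub z : exists z', G ((r ^+ i) z) = G ((r ^+ i.+1) z').
  have [q qE] := IH z.
  have /Bezout_eq1_coprimepP[[v w] /= vw] : coprimep p 'X^(n.+1).
    by rewrite coprimep_expr // coprimepX.
  have pv : H p * H v = 1.
    rewrite -rmorphM mulrC /= -[RHS](rmorph1 (horner_mx a)) -vw rmorphD /=.
    rewrite [X in _ = _ + X]rmorphM /= rmorphXn /= horner_mx_X rb_one_nilpotent.
    by rewrite mulr0 addr0.
  have [y yE] := rb_casimir_mull i.+1 (q * v) x; exists y.
  rewrite -yE exprS lfun_mulE pE qE rmorphM /=.
  have aH (h : {poly F}) : H h * a ^+ i = a ^+ i * H h.
    exact/esym/commr_sym/commrX/commr_sym/comm_horner_mx_a.
  have vp : H v * H p = 1 by rewrite -[RHS]pv -!rmorphM mulrC.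
  by rewrite -mulrA [H v * _]mulrA aH -mulrA vp mulr1 aH.
(* [casimir_congr] allows [sub] to be reapplied under further powers of R, until nilpotency of R
   makes the value 0. *)
have sub_n m z : exists z', G ((r ^+ i) z) = G ((r ^+ (i + m)) z').
  elim: m z => [|m IHm] z; first by exists z; rewrite addn0.
  have [z1 ->] := IHm z; have [z2 e] := sub z1; exists z2.
  rewrite exprD lfun_mulE (casimir_congr m e) -[(r ^+ m) _]lfun_mulE.
  by rewrite -exprD addSnnS.
exists 0; rewrite rmorph0 mulr0 exprS lfun_mulE.
have [z ->] := sub_n (2 * n.+1)%N (r x).
by rewrite exprD rb_nilpotent mulr0 zero_lfunE linear0.
Qed.

(** G R^(i+1) lands in a^(i+1) F[a], and each of the n - i later applications of R adds a factor
    [a], up to a^(n+1) = 0. *)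
Lemma rb_casimir_eq0 i : (i <= n)%N -> r ^+ i * (r * G) * r ^+ (n - i) = 0.
Proof.
move=> ik; apply/lfunP => x; rewrite mulrA -exprSr !lfun_mulE zero_lfunE.
have [p ->] := casimir_rb_ideal i.+1 x.
have [q ->] := rb_iter_ideal (n - i) i.+1 p.
by rewrite addSn subnKC // rb_one_nilpotent mul0r.
Qed.

End Cyclic.

Lemma rb_nilpotent_zero : r ^+ (2 * n).+1 = 0.
Proof.
have uE k : (r * rbopS 0 R) ^+ k = r ^+ (2 * k) by rewrite rbopS0 -expr2 -exprM.
have [an|an] := eqVneq (a ^+ n) 0.
  have := rb_annihilator F0 RB (monicXn F n) (size_polyXn F n).
  rewrite horner_alg_mx rmorphXn /= horner_mx_X an uE => /(_ erefl) e.
  by rewrite exprS e mulr0.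
pose G := \sum_(i < n.+1) L ^+ (n - i) * Q ^+ i.
(* The extra factor [r] raises r^(2n) to r^(2n+1) and supplies the positive power of R needed in
   [rb_casimir_eq0]. *)
have dG : adn r n (r * G) = r * ((- (r * rbopS 0 R)) ^+ n *+ (n`! * n.+1)).
  rewrite adnM_comm // raddf_sum /=.
  rewrite (eq_bigr (fun=> (- (r * rbopS 0 R)) ^+ n *+ n`!)).
    by rewrite sumr_const card_ord mulrnA.
  move=> i _.
  have := ad_degree_monomial (comm_rNu 0 R) (ad_L RB) (ad_Q RB) (n - i) i.
  by rewrite subnK // -ltnS.
move: dG; rewrite adn_sum_eq0; last exact: rb_casimir_eq0.
rewrite mulrnAr => /esym/mulrn_eq0_char0 => /(_ F0).
rewrite muln_gt0 fact_gt0 => /(_ isT); rewrite exprNn uE -signr_odd mulr_sign exprS.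
by case: odd => //; rewrite mulrN => /eqP; rewrite oppr_eq0 => /eqP.
Qed.

End UpperBoundZero.

(** * An operator of maximal index *)

Section ExtremalOperator.
Variables (F : fieldType) (n : nat) (lam : F).
Local Notation M := 'M[F]_n.+1.
Implicit Types (K H X Y : M).

Definition shift_mx : M := \matrix_(i, j) (j == i.+1 :> nat)%:R.

(** Solves H(i+1, j) - H(i, j-1) = K(i, j) by sums over the diagonal l - m = j + 1 - i of [K]: over
    the rows above i when i <= j, starting from the zero row 0, and minus the rows from i on when j
    < i, starting from the bottom. Natural number indices give the value 0 at i = n+1. *)
Definition diag_sum K (i j : nat) : F :=
  \sum_(m < n.+1) \sum_(l < n.+1)
    ((m + j.+1 == i + l)%N%:R * ((m < i)%N%:R - (j < i)%N%:R)) * K m l.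

Definition int_mx K : M := \matrix_(i, j) diag_sum K i j.

Lemma diag_sum_linear i j : linear (fun K => diag_sum K i j : F^o).
Proof.
move=> c X Y; rewrite /diag_sum scaler_sumr -big_split; apply: eq_bigr => m _ /=.
rewrite scaler_sumr -big_split; apply: eq_bigr => l _ /=.
by rewrite !mxE mulrDr mulrCA.
Qed.

Lemma int_mx_linear : linear int_mx.
Proof.
by move=> c X Y; apply/matrixP => i j; rewrite !mxE diag_sum_linear.
Qed.

Lemma sub_mxE X Y i j : (X - Y) i j = X i j - Y i j.
Proof. by rewrite mxE [X in _ + X]mxE. Qed.

Lemma shift_mulE X (i j : 'I_n.+1) :
  (shift_mx * X) i j = if (i < n)%N then X (inord i.+1) j else 0.
Proof.
rewrite !mxE; case: ifP => [ltin | /negbT leni].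
  rewrite (bigD1 (inord i.+1)) //= big1 ?addr0 => [|k ki].
    by rewrite mxE inordK // eqxx mul1r.
  rewrite mxE (_ : (k == i.+1 :> nat) = false) ?mul0r //.
  by apply: contraNF ki => /eqP ki; apply/eqP/val_inj; rewrite /= inordK.
rewrite big1 // => k _; rewrite mxE (_ : (k == i.+1 :> nat) = false) ?mul0r //.
by have := ltn_ord k; lia.
Qed.

Lemma mul_shiftE X (i j : 'I_n.+1) :
  (X * shift_mx) i j = if (0 < j)%N then X i (inord j.-1) else 0.
Proof.
rewrite !mxE; case: ifP => [j0 | /negbT j0].
  have jn : (j.-1 < n.+1)%N by have := ltn_ord j; lia.
  rewrite (bigD1 (inord j.-1)) //= big1 ?addr0 => [|k kj].
    by rewrite mxE inordK // prednK // eqxx mulr1.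
  rewrite mxE (_ : (j == k.+1 :> nat) = false) ?mulr0 //.
  by apply: contraNF kj => /eqP kj; apply/eqP/val_inj; rewrite /= inordK // kj.
rewrite big1 // => k _; rewrite mxE (_ : (j == k.+1 :> nat) = false) ?mulr0 //.
by lia.
Qed.

Lemma int_mx_row0 K j : int_mx K ord0 j = 0.
Proof.
rewrite mxE /diag_sum big1 // => m _; rewrite big1 // => l _.
by rewrite !ltn0 subrr mulr0 mul0r.
Qed.

Lemma int_mx_commutator K (i j : 'I_n.+1) : (0 < j)%N ->
  (shift_mx * int_mx K - int_mx K * shift_mx) i j = K i j.
Proof.
move=> j0; rewrite sub_mxE mul_shiftE shift_mulE j0.
rewrite [int_mx _ _ _ in X in _ - X]mxE.
have -> : (if (i < n)%N then int_mx K (inord i.+1) j else 0) = diag_sum K i.+1 j.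
  case: ifP => [ltin | /negbT leni]; first by rewrite mxE inordK.
  rewrite /diag_sum big1 // => m _; rewrite big1 // => l _.
  have -> : (m < i.+1)%N by have := ltn_ord m; lia.
  have -> : (j < i.+1)%N by have := ltn_ord j; lia.
  by rewrite subrr mulr0 mul0r.
rewrite inordK; last by have := ltn_ord j; lia.
(* Both sums run over the same diagonal with the same sign rule; their coefficients differ only in
   row m = i. *)
rewrite /diag_sum prednK // -sumrB (bigD1 i) //= [X in _ + X]big1 ?addr0 => [|m mi].
  rewrite -sumrB (bigD1 j) //= big1 ?addr0 => [|l lj].
    rewrite addSn addnS !eqxx ltnn ltnSn !mul1r -mulrBl.
    rewrite (_ : (j <= i)%N = (j < i.+1)%N); last by lia.
    by rewrite sub0r opprK subrK mul1r.
  rewrite (_ : (_ == _) = false); last first.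
    by apply: contraNF lj => /eqP e; apply/eqP/val_inj => /=; lia.
  rewrite (_ : (_ == _) = false) ?mul0r ?subrr //.
  by apply: contraNF lj => /eqP e; apply/eqP/val_inj => /=; lia.
rewrite -sumrB big1 // => l _; rewrite -mulrBl.
rewrite (_ : (m + j == i + l)%N = (m + j.+1 == i.+1 + l)%N); last by lia.
rewrite (_ : (m < i.+1)%N = (m < i)%N); last first.
  have : m != i :> nat by []. 
  lia.
rewrite (_ : (j <= i)%N = (j < i.+1)%N); last by lia.
by rewrite subrr mul0r.
Qed.

(** The equations propagate zeros along diagonals: downwards from row 0 for i <= j, upwards from the
    last row for j < i. *)
Lemma commutator_inj X :
    (forall j, X ord0 j = 0) ->
    (forall i j : 'I_n.+1, (0 < j)%N -> (shift_mx * X - X * shift_mx) i j = 0) ->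
  X = 0.
Proof.
move=> X0 dX.
have dXE (i j : nat) : (i <= n)%N -> (j < n)%N ->
    (if (i < n)%N then X (inord i.+1) (inord j.+1) else 0) =
    X (inord i) (inord j).
  move=> ltin ltjn; have := dX (inord i) (inord j.+1).
  rewrite sub_mxE shift_mulE mul_shiftE !inordK //= => /(_ isT)/eqP.
  by rewrite subr_eq0 => /eqP.
have upper (i t : nat) : (i + t <= n)%N -> X (inord i) (inord (i + t)) = 0.
  elim: i => [|i IH] it.
    rewrite -[RHS](X0 (inord (0 + t))); congr (X _ _).
    by apply: val_inj; rewrite /= inordK.
  have := dXE i (i + t)%N; rewrite (_ : (i < n)%N) ?IH; try lia.
  by apply; lia.
have lower (k j : nat) : (j + k < n)%N -> X (inord (n - k)) (inord j) = 0.
  elim: k j => [|k IH] j jk.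
    by rewrite subn0 -dXE ?ltnn //; lia.
  rewrite -dXE; [|lia|lia]; rewrite (_ : (n - k.+1 < n)%N); last by lia.
  by rewrite -(IH j.+1); [congr (X (inord _) _); lia|lia].
apply/matrixP => i j; rewrite mxE -(inord_val i) -(inord_val j).
have [ij|ji] := leqP i j.
  by rewrite -(upper i (j - i)%N) ?subnKC // -ltnS.
rewrite -(lower (n - i)%N j) ?subKn //; have := ltn_ord i; move: ji; lia.
Qed.

Definition rb_ext K : M := int_mx (K * (1 + lam *: shift_mx)).

Lemma rb_ext_linear : linear rb_ext.
Proof.
by move=> c X Y; rewrite /rb_ext mulrDl -scalerAl int_mx_linear.
Qed.

HB.instance Definition _ :=
  GRing.isSemilinear.Build F M M _ rb_ext
    (GRing.semilinear_linear rb_ext_linear).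

(** Both sides have zero first row, so by [commutator_inj] it suffices to compare commutators with J
    outside column 0. Errors supported in column 0 remain so under left multiplication. *)
Lemma rb_extP : RotaBaxter lam (rb_ext : {linear M -> M}).
Proof.
pose N := shift_mx; pose S : M := 1 + lam *: N.
pose col0 X := forall i j : 'I_n.+1, (0 < j)%N -> X i j = 0.
have col0M X Y : col0 Y -> col0 (X * Y).
  by move=> Y0 i j j0; rewrite mxE big1 // => k _; rewrite Y0 // mulr0.
have ext X : exists2 V, col0 V & N * rb_ext X = rb_ext X * N + X * S - V.
  exists (X * S - (N * rb_ext X - rb_ext X * N)) => [i j j0|].
    by rewrite sub_mxE int_mx_commutator // subrr.
  by rewrite opprB -[RHS]addrA [X in _ = _ + X]addrC subrK [RHS]addrC subrK.
have XSE X : X * S = X + lam *: (X * N) by rewrite mulrDr mulr1 -scalerAr.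
have SXE X : S * X = X + lam *: (N * X) by rewrite mulrDl mul1r -scalerAl.
move: S => S in ext XSE SXE *.
move=> x y /=; have [V V0 NH] := ext x; have [W W0 NM] := ext y.
set H := rb_ext x in NH *; set K := rb_ext y in NM *.
set E := H * y + x * K + lam *: (x * y).
have [U U0 NE] := ext E; set D := rb_ext E in NE *.
have K0 j : K ord0 j = 0 by exact: int_mx_row0.
have H0 j : H ord0 j = 0 by exact: int_mx_row0.
have D0 j : D ord0 j = 0 by exact: int_mx_row0.
(* The one error multiplied on the right meets the zero first row of [K]. *)
have VK : V * K = 0.
  apply/matrixP => i j; rewrite !mxE big1 // => k _.
  have [k0|k0] := posnP k; last by rewrite V0 // mul0r.
  by rewrite (_ : k = ord0) ?K0 ?mulr0 //; apply: val_inj.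
apply/eqP; rewrite -subr_eq0; apply/eqP; apply: commutator_inj => [j|i j j0].
  rewrite sub_mxE -/D D0 subr0 mxE big1 // => k _.
  by rewrite H0 mul0r.
have -> : shift_mx * (H * K - D) - (H * K - D) * shift_mx
    = U - (H * W + lam *: (x * W)).
  rewrite -/N mulrBr NE mulrA NH mulrBl VK subr0 mulrDl -[H * N * K]mulrA NM.
  rewrite -[x * S * K]mulrA SXE NM.
  have -> : E * S =
      H * y * S + (x * K + lam *: (x * K * N)) + lam *: (x * y * S).
    by rewrite /E !mulrDl -scalerAl [x * K * S]XSE.
  rewrite !mulrDr -!scalerAr !mulrDr !mulrN mulrBl !mulrA.
  move: (H * K * N) (H * y * S) (H * W) (x * K) (x * K * N) (x * y * S).
  move: (x * W) (D * N).
  by move=> *; apply/matrixP => p q; rewrite !mxE; ring.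
rewrite sub_mxE U0 // sub0r mxE [X in _ + X]mxE !col0M //.
by rewrite mulr0 addr0 oppr0.
Qed.

(* [head_mx t] and [tail_mx t] describe the image of [E_(0,n)] under a product of
   [t], resp. [n + t], factors: it vanishes above the filtration degree reached
   by [i - j], where its only relevant entry is [(t, n)], resp. [(n, n - t)]. *)
Definition head_mx (t : nat) X := forall i j : 'I_n.+1,
  (t + j <= i + n)%N -> X i j = ((i == t :> nat) && (j == n :> nat))%:R.

Definition tail_mx (t : nat) X :=
  X ord_max (inord (n - t)) != 0 /\
  forall i j : 'I_n.+1, (j + t < i)%N -> X i j = 0.

Lemma mul_unipotentE X (m l : 'I_n.+1) : (X * (1 + lam *: shift_mx)) m l =
  X m l + lam * (if (0 < l)%N then X m (inord l.-1) else 0).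
Proof.
by rewrite mulrDr mulr1 mxE -scalerAr [X in _ + X]mxE mul_shiftE.
Qed.

(** The terms in [c] and [lam] only involve entries of [X] with i - j > t - n, which vanish. On the
    next diagonal the sum over m < i reaches row t only for i = t+1. *)
Lemma head_mx_step c t X : (t < n)%N -> head_mx t X ->
  head_mx t.+1 (rb_ext X + c *: X).
Proof.
move=> tn hX i j ij; rewrite mxE [(c *: X) i j]mxE hX; last by lia.
rewrite (_ : _ && _ = false) ?mulr0 ?addr0; last by apply/negP => /andP[]; lia.
have XSE (m l : 'I_n.+1) : (m + j.+1 == i + l)%N ->
    (X * (1 + lam *: shift_mx)) m l = ((m == t :> nat) && (l == n :> nat))%:R.
  move=> /eqP ml; rewrite mul_unipotentE hX; last by lia.
  case: ifP => l0; last by rewrite mulr0 addr0.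
  have ln := ltn_ord l; rewrite hX inordK; [|lia..].
  rewrite (_ : _ && (l.-1 == n) = false) ?mulr0 ?addr0 //.
  by apply/negP => /andP[]; lia.
have [tN nN] : (t < n.+1 /\ n < n.+1)%N by lia.
rewrite mxE /diag_sum (bigD1 (Ordinal tN)) //= [X in _ + X]big1 ?addr0
  => [|m mt]; last first.
  rewrite big1 // => l _; case: eqP => [/eqP ml|_]; last by rewrite !mul0r.
  rewrite XSE // (_ : (m == t :> nat) = false) ?mulr0 //.
  by apply: contraNF mt => /eqP e; apply/eqP/val_inj.
rewrite (bigD1 (Ordinal nN)) //= big1 ?addr0 => [|l ln]; last first.
  case: eqP => [/eqP ml|_]; last by rewrite !mul0r.
  rewrite XSE // (_ : (l == n :> nat) = false) ?andbF ?mulr0 //.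
  by apply: contraNF ln => /eqP e; apply/eqP/val_inj.
have jn := ltn_ord j.
case: eqP => [/eqP tj|tj]; last first.
  rewrite !mul0r (_ : (i == t.+1 :> nat) && _ = false) //.
  by apply/negP => /andP[]; lia.
rewrite XSE //= !eqxx mulr1 mul1r (_ : (j < i)%N = false) ?subr0; last by lia.
by congr (_%:R); congr nat_of_bool; lia.
Qed.

Lemma head_tail_mx X : head_mx n X -> tail_mx 0 X.
Proof.
move=> hX; split=> [|i j ji].
  rewrite subn0 hX ?inordK //= ?eqxx ?oner_eq0 //; lia.
rewrite hX; last by lia.
by rewrite (_ : _ && _ = false) //; apply/negP => /andP[]; have := ltn_ord i; lia.
Qed.

(** Below the main diagonal [diag_sum] is minus a sum over the rows from i on; in the last row a
    single term is left, so the new entry is the opposite of the old one. *)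
Lemma tail_mx_step c t X : (t < n)%N -> tail_mx t X ->
  tail_mx t.+1 (rb_ext X + c *: X).
Proof.
move=> tn [Xt X0].
have XS0 (m l : 'I_n.+1) : (l + t < m)%N -> (X * (1 + lam *: shift_mx)) m l = 0.
  move=> lm; rewrite mul_unipotentE X0 // add0r; case: ifP; rewrite ?mulr0 // => l0.
  by have ln := ltn_ord l; rewrite X0 ?mulr0 // inordK; lia.
split=> [|i j ji]; last first.
  rewrite mxE [(c *: X) i j]mxE X0 ?mulr0 ?addr0; last by lia.
  rewrite mxE /diag_sum big1 // => m _; rewrite big1 // => l _.
  case: eqP => ml; last by rewrite !mul0r.
  by rewrite XS0 ?mulr0 //; lia.
have tN : (n - t.+1 < n.+1)%N by lia.
have ltnn' : (n - t.+1 < n)%N by lia.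
rewrite mxE [(c *: X) _ _]mxE X0 ?inordK ?mulr0 ?addr0 //=; last by lia.
rewrite mxE /diag_sum inordK // (bigD1 ord_max) //= [X in _ + X]big1 ?addr0
  => [|m mn]; last first.
  have ltmn : (m < n)%N by rewrite ltn_neqAle -ltnS ltn_ord andbT.
  by rewrite big1 // => l _; rewrite ltmn ltnn' subrr mulr0 mul0r.
rewrite (bigD1 (inord (n - t))) //= big1 ?addr0 => [|l ln]; last first.
  rewrite (_ : (_ == _) = false) ?mul0r //; apply: contraNF ln => /eqP e.
  by apply/eqP/val_inj; rewrite /= inordK; lia.
rewrite inordK; last by lia.
rewrite (_ : (_ + _ == _ + _)%N) ?mul1r; last by rewrite /=; lia.
rewrite ltnn ltnn' sub0r mulN1r oppr_eq0.
rewrite mul_unipotentE; case: ifP => l0; last by rewrite mulr0 addr0.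
by rewrite [X in lam * X]X0 ?mulr0 ?addr0 //= !inordK; lia.
Qed.

Definition extremal_mx (t : nat) X :=
  ((t <= n)%N -> head_mx t X) /\ ((n <= t <= 2 * n)%N -> tail_mx (t - n) X).

Lemma extremal_mx_step c t X : (t < 2 * n)%N -> extremal_mx t X ->
  extremal_mx t.+1 (rb_ext X + c *: X).
Proof.
move=> tn [hX tX]; split=> [tn'|/andP[nt t2]].
  by apply: head_mx_step => //; apply: hX; lia.
have [nt'|nt'] := leqP n t; last first.
  have e : t.+1 = n by lia.
  have : head_mx t.+1 (rb_ext X + c *: X).
    by apply: head_mx_step => //; apply: hX; lia.
  by rewrite [in head_mx _]e e subnn; exact: head_tail_mx.
by rewrite subSn //; apply: tail_mx_step; [lia|apply: tX; lia].
Qed.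

Lemma extremal_mx_neq0 t X : (t <= 2 * n)%N -> extremal_mx t X -> X != 0.
Proof.
move=> t2 [hX tX]; have [tn|nt] := leqP t n.
  apply/eqP => X0; have := hX tn (inord t) ord_max.
  rewrite X0 mxE !inordK //= !eqxx.
  by move/(_ (leqnn _))/eqP; rewrite eq_sym oner_eq0.
have [|Xn _] := tX _; first by lia.
by apply: contraNneq Xn => ->; rewrite mxE.
Qed.

Lemma extremal_mx_iter c k t X : (t + k <= 2 * n)%N -> extremal_mx t X ->
  extremal_mx (t + k) (iter k (fun Y => rb_ext Y + c *: Y) X).
Proof.
elim: k => [|k IH] tk eX; first by rewrite addn0.
by rewrite addnS; apply: extremal_mx_step; [lia|apply: IH => //; lia].
Qed.

Lemma rb_ext_not_vanish k m : (m <= 2 * n)%N -> (k <= m)%N ->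
  ~ RBpow_vanish lam (rb_ext : {linear M -> M}) k m.
Proof.
move=> m2 km /(_ (delta_mx ord0 ord_max)) /=.
have e0 : extremal_mx 0 (delta_mx ord0 ord_max).
  have h0 : head_mx 0 (delta_mx ord0 ord_max).
    by move=> i j _; rewrite mxE; congr (_%:R).
  split=> // /andP[n0 _]; have n0' : n = 0%N by lia.
  rewrite sub0n; apply: head_tail_mx; by rewrite {1}n0'.
(* A factor R + lam is a step with c = lam, a factor R a step with c = 0. *)
have e1 := @extremal_mx_iter lam (m - k) 0 _ _ e0.
have := @extremal_mx_iter 0 k (m - k) _ _ (e1 _).
rewrite subnK // => /(_ m2) h.
set Y := iter k _ _; have -> : Y = iter k (fun Z => rb_ext Z + 0 *: Z)
   (iter (m - k) (fun y => rb_ext y + lam *: y) (delta_mx ord0 ord_max)).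
  by rewrite /Y; apply: eq_iter => Z; rewrite scale0r addr0.
apply/eqP/(extremal_mx_neq0 m2); apply: h; lia.
Qed.

End ExtremalOperator.

(** * The index of the matrix algebra *)

Lemma rb_bound_mx (F : fieldType) (n : nat) (lam : F) :
  [pchar F] =i pred0 -> rb_bound 'M[F]_n.+1 lam (2 * n).+1.
Proof.
move=> F0 R RB; have [lam0|lam0] := eqVneq lam 0.
  move: RB; rewrite lam0 => RB; exists (2 * n).+1 => //.
  by apply/RBpow_vanishE; rewrite subnn mul1r (rb_nilpotent_zero F0 RB).
have cX k l : GRing.comm (rbop R ^+ k) (rbopS lam R ^+ l).
  by apply/commrX/commr_sym/commrX/commr_sym; exact: comm_rs.
have [e|e] := rb_nilpotent_nonzero F0 RB lam0; [exists n.+1|exists n]; try lia;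
  apply/RBpow_vanishE; rewrite -cX -[RHS]e; congr (_ * _ ^+ _); lia.
Qed.

Theorem theorem4 (F : fieldType) (F_char0 : [pchar F] =i pred0) (n : nat)
    (lam : F) :
  rb_index 'M[F]_n.+1 lam = Some (2 * n.+1 - 1)%N.
Proof.
have -> : (2 * n.+1 - 1 = (2 * n).+1)%N by lia.
have upper := @rb_bound_mx F n lam F_char0.
rewrite /rb_index /min_nat; case: boolp.pselect => [exP|[]]; last first.
  by exists (2 * n).+1; apply/boolp.asboolP.
case: ex_minnP => m /boolp.asboolP bm min_m; congr Some; apply/eqP.
rewrite eqn_leq min_m; last exact/boolp.asboolP.
rewrite ltnNge; apply/negP => m2.
by have [k km] := bm _ (@rb_extP F n lam); exact: rb_ext_not_vanish.
Qed.
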